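(* For every closed formula $A$: $\mathsf{IKt}2 \vdash A$ if and only if $\mathfrak{B} \models A$ (i.e. $w \models_{\mathfrak{B}} A$ for every world $w$) for every birelational model $\mathfrak{B}$.
   Context: Formulas: $A ::= P \mid X \mid A\to B \mid \Box A \mid \blacksquare A \mid \forall X A$, with $P$ ranging over propositional symbols and $X$ over second-order variables. Abbreviations: $\bot := \forall X X$, $\neg A := A\to\bot$, $A\land B := \forall X((A\to B\to X)\to X)$, $A\lor B := \forall X((A\to X)\to(B\to X)\to X)$, $\Diamond A := \forall X(\Box(A\to\blacksquare X)\to X)$, and the backward diamond $\Diamond^{\bullet} A := \forall X(\blacksquare(A\to\Box X)\to X)$. $\mathsf{IKt}2$ is axiomatised by: second-order intuitionistic propositional logic (axioms $A\to B\to A$; $(A\to B\to C)\to(A\to B)\to A\to C$; $\forall X(A\to B)\to\forall XA\to\forall XB$; $A\to\forall XA$ for $X\notin\mathrm{fv}(A)$; full comprehension $\forall XA\to A[C/X]$ for any formula $C$; rules modus ponens and generalisation: from $A[P/X]$ infer $\forall XA$ for $P$ fresh); distribution $\Box(A\to B)\to\Box A\to\Box B$, $\Box(A\to B)\to\Diamond A\to\Diamond B$, $\blacksquare(A\to B)\to\blacksquare A\to\blacksquare B$, $\blacksquare(A\to B)\to\Diamond^{\bullet} A\to\Diamond^{\bullet} B$; necessitation rules from $A$ infer $\Box A$ and from $A$ infer $\blacksquare A$; tense axioms $\Diamond^{\bullet}\Box A\to A$, $A\to\Box\Diamond^{\bullet}A$, $\Diamond\blacksquare A\to A$, $A\to\blacksquare\Diamond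 A$. A birelational structure $\mathfrak{B}$ consists of a set $W$ of worlds, a partial order $\le$ on $W$, a class $\mathcal{W}\subseteq\mathcal{P}(W)$ of $\le$-upward-closed sets, an interpretation $P_{\mathfrak{B}}\in\mathcal{W}$ of each propositional symbol, and an accessibility relation $R\subseteq W\times W$ that is a bisimulation for $\le$ (if $vRw\le w'$ then $v\le v'Rw'$ for some $v'$; if $v'\ge vRw$ then $v'Rw'$ for some $w'\ge w$). Satisfaction for closed formulas (treating each $V\in\mathcal{W}$ as a propositional symbol interpreted by itself): $v\models P$ iff $v\in P_{\mathfrak{B}}$; $v\models A\to B$ iff for all $v'\ge v$, $v'\models A$ implies $v'\models B$; $v\models\Box A$ iff for all $v'\ge v$ and $v'Rw'$, $w'\models A$; $v\models\blacksquare A$ iff for all $v'\ge v$ and $u'Rv'$, $u'\models A$; $v\models\forall XA$ iff for all $v'\ge v$ and $V\in\mathcal{W}$, $v'\models A[V/X]$. A birelational model is a comprehensive structure: for every closed formula $C$ of the expanded language, $\{w\in W : w\models C\}\in\mathcal{W}$. *)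

(* Defs.v *)
From Stdlib Require Import Relations Ensembles Arith Lia.

Set Implicit Arguments.
Unset Strict Implicit.

(* Formulas over a type [P] of propositional symbols.  Second-order variables
   are de Bruijn indices, so formulas are taken up to renaming of bound
   variables.  [Box] is the white box (forward modality), [BBox] the black box
   (backward modality). *)
Inductive form (P : Type) : Type :=
| Atom : P -> form P
| Var : nat -> form P
| Imp : form P -> form P -> form P
| Box : form P -> form P
| BBox : form P -> form P
| All : form P -> form P.

Arguments Var {P} _.

Declare Scope form_scope.
Delimit Scope form_scope with form.
Bind Scope form_scope with form.
Notation "A --> B" := (Imp A B) (at level 55, right associativity) : form_scope.
Local Open Scope form_scope.

Fixpoint map_atoms (P Q : Type) (f : P -> Q) (A : form P) : form Q :=
  match A with
  | Atom p => Atom (f p)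
  | Var i => Var i
  | Imp A B => map_atoms f A --> map_atoms f B
  | Box A => Box (map_atoms f A)
  | BBox A => BBox (map_atoms f A)
  | All A => All (map_atoms f A)
  end.

Definition up_ren (r : nat -> nat) (i : nat) : nat :=
  match i with 0 => 0 | S j => S (r j) end.

Fixpoint ren (P : Type) (r : nat -> nat) (A : form P) : form P :=
  match A with
  | Atom p => Atom p
  | Var i => Var (r i)
  | Imp A B => ren r A --> ren r B
  | Box A => Box (ren r A)
  | BBox A => BBox (ren r A)
  | All A => All (ren (up_ren r) A)
  end.

(* [shift A] is [A] placed under one more quantifier, whose variable (index 0)
   is not free in it. *)
Definition shift (P : Type) (A : form P) : form P := ren S A.

Definition up (P : Type) (s : nat -> form P) (i : nat) : form P :=
  match i with 0 => Var 0 | S j => shift (s j) end.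

Fixpoint subst (P : Type) (s : nat -> form P) (A : form P) : form P :=
  match A with
  | Atom p => Atom p
  | Var i => s i
  | Imp A B => subst s A --> subst s B
  | Box A => Box (subst s A)
  | BBox A => BBox (subst s A)
  | All A => All (subst (up s) A)
  end.

(* [inst A C] is A[C/X] for the body [A] of a quantified formula [All A],
   X being index 0 of [A]. *)
Definition inst (P : Type) (A C : form P) : form P :=
  subst (fun i => match i with 0 => C | S j => Var j end) A.

Fixpoint closed_below (P : Type) (k : nat) (A : form P) : Prop :=
  match A with
  | Atom _ => True
  | Var i => i < k
  | Imp A B => closed_below k A /\ closed_below k B
  | Box A => closed_below k A
  | BBox A => closed_below k A
  | All A => closed_below (S k) A
  end.

Definition closed (P : Type) (A : form P) : Prop := closed_below 0 A.

Fixpoint fresh (P : Type) (p : P) (A : form P) : Prop :=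
  match A with
  | Atom q => p <> q
  | Var _ => True
  | Imp A B => fresh p A /\ fresh p B
  | Box A => fresh p A
  | BBox A => fresh p A
  | All A => fresh p A
  end.

Definition Dia (P : Type) (A : form P) : form P :=
  All (Box (shift A --> BBox (Var 0)) --> Var 0).

Definition BDia (P : Type) (A : form P) : form P :=
  All (BBox (shift A --> Box (Var 0)) --> Var 0).

(* The propositional symbols are countably many. *)
Definition formula : Type := form nat.

(* Axioms and rules range over all formulas, open ones included. *)
Inductive IKt2 : formula -> Prop :=
| ax_K A B : IKt2 (A --> B --> A)
| ax_S A B C : IKt2 ((A --> B --> C) --> (A --> B) --> A --> C)
| ax_all_dist A B : IKt2 (All (A --> B) --> All A --> All B)
| ax_all_vac A : IKt2 (A --> All (shift A))
| ax_comprehension A C : IKt2 (All A --> inst A C)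
| ax_box_dist A B : IKt2 (Box (A --> B) --> Box A --> Box B)
| ax_dia_dist A B : IKt2 (Box (A --> B) --> Dia A --> Dia B)
| ax_bbox_dist A B : IKt2 (BBox (A --> B) --> BBox A --> BBox B)
| ax_bdia_dist A B : IKt2 (BBox (A --> B) --> BDia A --> BDia B)
| ax_bdia_box A : IKt2 (BDia (Box A) --> A)
| ax_box_bdia A : IKt2 (A --> Box (BDia A))
| ax_dia_bbox A : IKt2 (Dia (BBox A) --> A)
| ax_bbox_dia A : IKt2 (A --> BBox (Dia A))
| rule_mp A B : IKt2 (A --> B) -> IKt2 A -> IKt2 B
| rule_gen A p : fresh p A -> IKt2 (inst A (Atom p)) -> IKt2 (All A)
| rule_nec_box A : IKt2 A -> IKt2 (Box A)
| rule_nec_bbox A : IKt2 A -> IKt2 (BBox A).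

Record birel_structure : Type := BirelStructure {
  world : Type;
  le : relation world;
  le_order : order world le;
  adm : Ensemble (Ensemble world);
  adm_upward : forall V, In _ adm V ->
    forall v v', le v v' -> In _ V v -> In _ V v';
  val : nat -> Ensemble world;
  val_adm : forall p, In _ adm (val p);
  acc : relation world;
  acc_forth : forall v w w', acc v w -> le w w' ->
    exists v', le v v' /\ acc v' w';
  acc_back : forall v v' w, le v v' -> acc v w ->
    exists w', acc v' w' /\ le w w'
}.

Arguments adm : clear implicits.
Arguments val : clear implicits.

(* The expanded language: every admissible set is a propositional symbol. *)
Inductive esymbol (B : birel_structure) : Type :=
| Sym : nat -> esymbol B
| Adm : forall V : Ensemble (world B), In _ (adm B) V -> esymbol B.

Arguments Sym {B} _.

Definition interp (B : birel_structure) (a : esymbol B) : Ensemble (world B) :=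
  match a with Sym p => val B p | @Adm _ V _ => V end.

Fixpoint size (P : Type) (A : form P) : nat :=
  match A with
  | Atom _ => 1
  | Var _ => 1
  | Imp A B => 1 + size A + size B
  | Box A => 1 + size A
  | BBox A => 1 + size A
  | All A => 1 + size A
  end.

(* Satisfaction is defined by recursion on size, since A[V/X] is not a subterm
   of [All A]; [n] bounds the size.  Only closed formulas matter, and a free
   variable is given the dummy value [False].  The defining clauses are the
   lemmas [sat_atom] to [sat_all] below. *)
Fixpoint sat_upto (B : birel_structure) (n : nat) (v : world B)
    (A : form (esymbol B)) : Prop :=
  match n with
  | 0 => False
  | S n =>
    match A with
    | Atom a => In _ (interp a) v
    | Var _ => False
    | Imp A1 A2 => forall v', le v v' -> sat_upto n v' A1 -> sat_upto n v' A2
    | Box A => forall v' w', le v v' -> acc v' w' -> sat_upto n w' A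
    | BBox A => forall v' u', le v v' -> acc u' v' -> sat_upto n u' A
    | All A => forall v' V (hV : In _ (adm B) V), le v v' ->
        sat_upto n v' (inst A (Atom (Adm hV)))
    end
  end.

Definition sat (B : birel_structure) (v : world B) (A : form (esymbol B)) :
  Prop := sat_upto (size A) v A.

Definition comprehensive (B : birel_structure) : Prop :=
  forall C : form (esymbol B), closed C ->
    In _ (adm B) (fun w => sat w C).

Record birel_model : Type := BirelModel {
  model_structure :> birel_structure;
  model_comprehensive : comprehensive model_structure
}.

Definition valid (B : birel_structure) (A : formula) : Prop :=
  forall w : world B, sat w (map_atoms Sym A).

Lemma size_ren (P : Type) (A : form P) r : size (ren r A) = size A.
Proof. revert r; induction A; intros r; simpl; auto. Qed.

Lemma size_subst (P : Type) (A : form P) s :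
  (forall i, size (s i) = 1) -> size (subst s A) = size A.
Proof.
  revert s; induction A; intros s Hs; simpl; auto.
  f_equal; apply IHA; intros [|i]; simpl; auto.
  unfold shift; rewrite size_ren; auto.
Qed.

Lemma size_inst_atom (P : Type) (A : form P) a : size (inst A (Atom a)) = size A.
Proof. apply size_subst; intros [|i]; reflexivity. Qed.

Lemma sat_upto_irrel (B : birel_structure) n m (v : world B) A :
  size A <= n -> size A <= m -> sat_upto n v A <-> sat_upto m v A.
Proof.
  revert m v A; induction n as [|n IH]; intros m v A Hn Hm.
  - destruct A; simpl in Hn; lia.
  - destruct m as [|m]; [destruct A; simpl in Hm; lia|].
    destruct A as [a|i|A1 A2|A|A|A]; simpl in *; try tauto.
    + assert (E1 : forall u, sat_upto n u A1 <-> sat_upto m u A1)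
        by (intro; apply IH; lia).
      assert (E2 : forall u, sat_upto n u A2 <-> sat_upto m u A2)
        by (intro; apply IH; lia).
      split; intros H v' Hv H1; apply E2, H, E1; trivial.
    + assert (E : forall u, sat_upto n u A <-> sat_upto m u A)
        by (intro; apply IH; lia).
      split; intros H v' w' Hv Hw; apply E, (H v'); trivial.
    + assert (E : forall u, sat_upto n u A <-> sat_upto m u A)
        by (intro; apply IH; lia).
      split; intros H v' u' Hv Hu; apply E, (H v'); trivial.
    + assert (E : forall u V (hV : In _ (adm B) V),
               sat_upto n u (inst A (Atom (Adm hV)))
               <-> sat_upto m u (inst A (Atom (Adm hV))))
        by (intros; apply IH; rewrite size_inst_atom; lia).
      split; intros H v' V hV Hv; apply E, H; trivial.
Qed.

Lemma sat_atom (B : birel_structure) (v : world B) a :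
  sat v (Atom a) <-> In _ (interp a) v.
Proof. reflexivity. Qed.

Lemma sat_imp (B : birel_structure) (v : world B) A1 A2 :
  sat v (A1 --> A2) <-> forall v', le v v' -> sat v' A1 -> sat v' A2.
Proof.
  unfold sat; simpl.
  assert (E1 : forall u : world B,
             sat_upto (size A1 + size A2) u A1 <-> sat_upto (size A1) u A1)
    by (intro; apply sat_upto_irrel; lia).
  assert (E2 : forall u : world B,
             sat_upto (size A1 + size A2) u A2 <-> sat_upto (size A2) u A2)
    by (intro; apply sat_upto_irrel; lia).
  split; intros H v' Hv H1; apply E2, H, E1; trivial.
Qed.

Lemma sat_box (B : birel_structure) (v : world B) A :
  sat v (Box A) <-> forall v' w', le v v' -> acc v' w' -> sat w' A.
Proof. reflexivity. Qed.

Lemma sat_bbox (B : birel_structure) (v : world B) A :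
  sat v (BBox A) <-> forall v' u', le v v' -> acc u' v' -> sat u' A.
Proof. reflexivity. Qed.

Lemma sat_all (B : birel_structure) (v : world B) A :
  sat v (All A) <->
  forall v' V (hV : In _ (adm B) V), le v v' -> sat v' (inst A (Atom (Adm hV))).
Proof.
  unfold sat; simpl.
  split; intros H v' V hV Hv; specialize (H v' V hV Hv);
    rewrite size_inst_atom in *; exact H.
Qed.

(* Main.v *)
(* Soundness: reading variables and symbols as admissible sets, comprehension
   says that every formula denotes an admissible set, and each axiom and rule is
   checked directly; the two halves of the bisimulation condition validate
   [A -> Box (BDia A)] and [A -> BBox (Dia A)].

   Completeness: all primitive connectives are negative, so no primeness is
   needed and the worlds of the canonical model are the theories [Th F] of single
   formulas, ordered by inclusion, with [Th F] related to [Th G] when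
   [F |- Dia G] and [G |- BDia F].  If moreover [G' |- G], then [F /\ Dia G']
   witnesses one bisimulation condition, and dually.  For the truth lemma, if
   [Box A] is forced at [F] one looks at the successor [BDia F] of
   [F /\ Dia (BDia F)] to get [BDia F |- A], hence [F |- Box A] by adjunction.
   As worlds are finitely generated, a fresh symbol is always available, so the
   quantifier has a constant domain. *)

From Stdlib Require Import Relations Ensembles Arith Lia.
From Stdlib Require Import FunctionalExtensionality PropExtensionality
  ProofIrrelevance IndefiniteDescription.
Require Import Defs.

Set Implicit Arguments.
Unset Strict Implicit.
Local Open Scope form_scope.

(** * Calculus of simultaneous substitutions *)

Definition scons (T : Type) (x : T) (s : nat -> T) (i : nat) : T :=
  match i with 0 => x | S j => s j end.

(** Replaces symbols and variables at once. [subst] and [map_atoms] are special cases, so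
    commutation with evaluation is proved only once. Replacing symbols by formulas also turns
    formulas of the expanded language into plain ones. *)
Fixpoint bind (P Q : Type) (g : P -> form Q) (s : nat -> form Q) (A : form P) :
  form Q :=
  match A with
  | Atom p => g p
  | Var i => s i
  | Imp A B => bind g s A --> bind g s B
  | Box A => Box (bind g s A)
  | BBox A => BBox (bind g s A)
  | All A => All (bind (fun p => shift (g p)) (up s) A)
  end.

Lemma up_Var P : up Var = @Var P.
Proof. extensionality i; destruct i; reflexivity. Qed.

Lemma bind_Atom P (s : nat -> form P) A : bind (@Atom P) s A = subst s A.
Proof.
  revert s; induction A; intros s; simpl; f_equal; auto.
Qed.

Lemma bind_Atom_Var P Q (f : P -> Q) A :
  bind (fun p => Atom (f p)) Var A = map_atoms f A.
Proof.
  induction A as [| | | | |A IH]; simpl; f_equal; auto.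
  rewrite up_Var; exact IH.
Qed.

Lemma subst_Var P (A : form P) : subst Var A = A.
Proof. induction A; simpl; rewrite ?up_Var; f_equal; auto. Qed.

Lemma ren_ren P (r q : nat -> nat) (A : form P) :
  ren r (ren q A) = ren (fun i => r (q i)) A.
Proof.
  revert r q; induction A as [| | | | |A IH]; intros r q; simpl; f_equal; auto.
  rewrite IH; f_equal; extensionality i; destruct i; reflexivity.
Qed.

Lemma subst_ren P (s : nat -> form P) r A :
  subst s (ren r A) = subst (fun i => s (r i)) A.
Proof.
  revert s r; induction A as [| | | | |A IH]; intros s r; simpl; f_equal; auto.
  rewrite IH; f_equal; extensionality i; destruct i; reflexivity.
Qed.

Lemma ren_subst P (s : nat -> form P) r A :
  ren r (subst s A) = subst (fun i => ren r (s i)) A.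
Proof.
  revert s r; induction A as [| | | | |A IH]; intros s r; simpl; f_equal; auto.
  rewrite IH; f_equal; extensionality i; destruct i; [reflexivity|].
  simpl; unfold shift; rewrite !ren_ren; reflexivity.
Qed.

Lemma subst_up_shift P (s : nat -> form P) A :
  subst (up s) (shift A) = shift (subst s A).
Proof. unfold shift; rewrite subst_ren, ren_subst; reflexivity. Qed.

Lemma subst_bind P Q (g : P -> form Q) s t A :
  subst t (bind g s A) = bind (fun p => subst t (g p)) (fun i => subst t (s i)) A.
Proof.
  revert g s t; induction A as [| | | | |A IH]; intros g s t; simpl; f_equal; auto.
  rewrite IH; f_equal; [extensionality p|extensionality i; destruct i as [|i]];
    simpl; auto using subst_up_shift.
Qed.

Lemma inst_shift P (A C : form P) : inst (shift A) C = A.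
Proof. unfold inst, shift; rewrite subst_ren; apply subst_Var. Qed.

Lemma inst_bind_up P Q (g : P -> form Q) s A C :
  inst (bind (fun p => shift (g p)) (up s) A) C = bind g (scons C s) A.
Proof.
  unfold inst at 1; rewrite subst_bind; f_equal.
  - extensionality p; apply inst_shift.
  - extensionality i; destruct i as [|i]; [reflexivity|apply inst_shift].
Qed.

Lemma inst_subst_up P (s : nat -> form P) A C :
  inst (subst (up s) A) C = subst (scons C s) A.
Proof. rewrite <- !bind_Atom; exact (inst_bind_up (@Atom P) s A C). Qed.

Lemma subst_closed_below P k (A : form P) s :
  closed_below k A -> (forall i, i < k -> s i = Var i) -> subst s A = A.
Proof.
  revert k s; induction A as [| |A IHA B IHB|A IH|A IH|A IH]; intros k s H Hs;
    simpl in *; f_equal; try (destruct H); eauto.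
  apply (IH (S k)); [exact H|].
  intros [|i] Hi; [reflexivity|].
  simpl; rewrite Hs by lia; reflexivity.
Qed.

Lemma closed_below_map_atoms P Q (f : P -> Q) k A :
  closed_below k A -> closed_below k (map_atoms f A).
Proof.
  revert k; induction A; intros k H; simpl in *; intuition auto.
Qed.

Lemma closed_below_bind_atoms P Q (f : P -> Q) (s : nat -> form Q) k A :
  (forall i, closed_below k (s i)) ->
  closed_below k (bind (fun p => Atom (f p)) s A).
Proof.
  assert (R : forall (C : form Q) k r, closed_below k C ->
            forall l, (forall i, i < k -> r i < l) -> closed_below l (ren r C)).
  { intros C; induction C as [| |A1 IHA A2 IHB|A1 IH|A1 IH|A1 IH];
      intros k' r H l Hr; simpl in *; intuition eauto.
    apply (IH (S k')); [exact H|].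
    intros [|i] Hi; simpl; [lia|]; specialize (Hr i); lia. }
  revert s k; induction A as [| | | | |A IH]; intros s k Hs; simpl; auto.
  apply IH; intros [|i]; simpl; [lia|].
  apply R with (k := k); [apply Hs|intros; lia].
Qed.

(** * Denotational semantics with environments, and its agreement with [sat] *)

Section Semantics.
Variable B : birel_structure.

(** Quantifiers extend the environment instead of substituting, so the recursion is structural and
    open formulas get a genuine denotation. *)
Fixpoint eval (P : Type) (I : P -> Ensemble (world B))
    (s : nat -> Ensemble (world B)) (A : form P) : Ensemble (world B) :=
  match A with
  | Atom p => I p
  | Var i => s i
  | Imp A1 A2 => fun v => forall v', le v v' -> eval I s A1 v' -> eval I s A2 v'
  | Box A => fun v => forall v' w', le v v' -> acc v' w' -> eval I s A w'
  | BBox A => fun v => forall v' u', le v v' -> acc u' v' -> eval I s A u'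
  | All A => fun v => forall v' V, In _ (adm B) V -> le v v' ->
      eval I (scons V s) A v'
  end.

Lemma ensemble_ext T (U V : Ensemble T) : (forall x, U x <-> V x) -> U = V.
Proof.
  intro H; extensionality x; apply propositional_extensionality, H.
Qed.

Lemma eval_All_ext P Q (I : P -> _) s (A : form P) (J : Q -> _) t (C : form Q) :
  (forall V, eval I (scons V s) A = eval J (scons V t) C) ->
  eval I s (All A) = eval J t (All C).
Proof.
  intro H; apply ensemble_ext; intro v; simpl.
  split; intros K v' V hV Hv; specialize (K v' V hV Hv);
    [rewrite <- H|rewrite H]; exact K.
Qed.

Lemma eval_ren P (I : P -> _) s r A :
  eval I s (ren r A) = eval I (fun i => s (r i)) A.
Proof.
  revert s r; induction A as [| |A1 IH1 A2 IH2|A IH|A IH|A IH]; intros s r;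
    try (simpl; rewrite ?IH, ?IH1, ?IH2; reflexivity).
  apply eval_All_ext; intro V; rewrite IH.
  f_equal; extensionality i; destruct i; reflexivity.
Qed.

Lemma eval_shift P (I : P -> _) V s A : eval I (scons V s) (shift A) = eval I s A.
Proof. exact (eval_ren I (scons V s) S A). Qed.

Lemma eval_bind P Q (I : Q -> _) s (g : P -> form Q) t A :
  eval I s (bind g t A) =
  eval (fun p => eval I s (g p)) (fun i => eval I s (t i)) A.
Proof.
  revert g s t; induction A as [| |A1 IH1 A2 IH2|A IH|A IH|A IH]; intros g s t;
    try (simpl; rewrite ?IH, ?IH1, ?IH2; reflexivity).
  apply eval_All_ext; intro V; rewrite IH.
  f_equal; [extensionality p; apply eval_shift|].
  extensionality i; destruct i; [reflexivity|apply eval_shift].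
Qed.

Lemma eval_inst P (I : P -> _) s A C :
  eval I s (inst A C) = eval I (scons (eval I s C) s) A.
Proof.
  unfold inst; rewrite <- bind_Atom, eval_bind.
  f_equal; extensionality i; destruct i; reflexivity.
Qed.

Lemma eval_fresh p (A : formula) (I J : nat -> Ensemble (world B)) s :
  fresh p A -> (forall q, p <> q -> I q = J q) -> eval I s A = eval J s A.
Proof.
  intros H HIJ; revert s H;
    induction A as [| |A1 IH1 A2 IH2|A IH|A IH|A IH]; intros s H; simpl in H;
    try (simpl; rewrite ?IH by tauto; reflexivity).
  - apply HIJ, H.
  - simpl; rewrite IH1, IH2 by tauto; reflexivity.
  - apply eval_All_ext; intro V; apply IH, H.
Qed.

(** Filling every variable with a symbol avoids the dummy value of [sat] on variables. The induction
    passes a quantifier because instantiating with [Adm hV] merely extends [a] to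
    [scons (Adm hV) a]. *)
Lemma sat_subst_eval (a : nat -> esymbol B) A w :
  sat w (subst (fun i => Atom (a i)) A) <->
  eval (@interp B) (fun i => interp (a i)) A w.
Proof.
  revert a w; induction A as [| |A1 IH1 A2 IH2|A IH|A IH|A IH]; intros a w;
    simpl subst; try reflexivity.
  - rewrite sat_imp; simpl.
    split; intros H v' Hv H1; apply IH2, H, IH1; trivial.
  - rewrite sat_box; simpl.
    split; intros H v' w' Hv Hw; apply IH, (H v'); trivial.
  - rewrite sat_bbox; simpl.
    split; intros H v' w' Hv Hw; apply IH, (H v'); trivial.
  - rewrite sat_all; simpl.
    assert (E : forall v V (hV : In _ (adm B) V),
      sat v (inst (subst (up (fun i => Atom (a i))) A) (Atom (Adm hV))) <->
      eval (@interp B) (scons V (fun i => interp (a i))) A v).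
    { intros v V hV; rewrite inst_subst_up.
      replace (scons _ _) with (fun i => Atom (scons (Adm hV) a i))
        by (extensionality i; destruct i; reflexivity).
      rewrite IH.
      replace (fun i => interp (scons (Adm hV) a i))
        with (scons V (fun i => interp (a i)))
        by (extensionality i; destruct i; reflexivity).
      reflexivity. }
    split; intros H v' V hV Hv; apply (E _ _ hV), H; trivial.
Qed.

Lemma sat_closed_eval (A : form (esymbol B)) s w :
  closed A -> sat w A <-> eval (@interp B) s A w.
Proof.
  intro hA.
  assert (E : forall t, subst t A = A)
    by (intro; apply subst_closed_below with (k := 0); [exact hA|lia]).
  (* [Sym 0] is an arbitrary filler, as [A] is closed. Inserting the same filler on both sides
     afterwards removes the dependence on [s]. *)
  rewrite <- (E (fun _ => Atom (Sym 0))) at 1.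
  rewrite sat_subst_eval.
  rewrite <- (E (fun _ => Atom (Sym 0))), <- bind_Atom, !eval_bind.
  reflexivity.
Qed.

Lemma sat_map_atoms_eval (A : formula) s w :
  closed A -> sat w (map_atoms Sym A) <-> eval (val B) s A w.
Proof.
  intro hA; rewrite (sat_closed_eval s) by (apply closed_below_map_atoms, hA).
  rewrite <- bind_Atom_Var, eval_bind; reflexivity.
Qed.
End Semantics.

(** * Admissibility of denotations, and soundness *)

Lemma eval_adm (B : birel_model) P (I : P -> _) s A :
  (forall p, In _ (adm B) (I p)) -> (forall i, In _ (adm B) (s i)) ->
  In _ (adm B) (eval I s A).
Proof.
  intros hI hs.
  (* The admissible sets [I p] and [s i] are themselves symbols of the expanded language; [C] names
     them and is closed, so comprehension applies. *)
  set (C := bind (fun p => Atom (Adm (hI p))) (fun i => Atom (Adm (hs i))) A).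
  assert (hC : closed C).
  { apply (closed_below_bind_atoms (fun p => Adm (hI p))); simpl; trivial. }
  replace (eval I s A) with (fun w => sat w C).
  - apply model_comprehensive, hC.
  - apply ensemble_ext; intro w.
    rewrite (sat_closed_eval s) by exact hC.
    unfold C; rewrite eval_bind; reflexivity.
Qed.

(** Quantifying over [s] accommodates open formulas; quantifying over [I] lets the generalisation
    rule reinterpret its fresh symbol. *)
Lemma soundness (A : formula) : IKt2 A ->
  forall (B : birel_model) I s,
    (forall p, In _ (adm B) (I p)) -> (forall i, In _ (adm B) (s i)) ->
    forall w, eval I s A w.
Proof.
  intros H B; destruct (le_order B) as [Hrefl Htrans _].
  unfold reflexive, transitive in *.
  induction H as [A C|A C D|A C|A|A C|A C|A C|A C|A C|A|A|A|A
    |A C H1 IH1 H2 IH2|A p hp H IH|A H IH|A H IH]; intros I s hI hs w;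
    (* Persistence follows from comprehension: denotations are admissible, and admissible sets are
       upward closed. *)
    assert (Hup : forall F t v v', (forall i, In _ (adm B) (t i)) ->
      le v v' -> eval I t F v -> eval I t F v')
      by (intros F t v v' ht; apply adm_upward, eval_adm; auto);
    assert (hev : forall F, In _ (adm B) (eval I s F))
      by (intros; apply eval_adm; auto).
  - intros v1 L1 H1 v2 L2 _; exact (Hup A s v1 v2 hs L2 H1).
  - intros v1 L1 H1 v2 L2 H2 v3 L3 H3.
    exact (H1 v3 (Htrans _ _ _ L2 L3) H3 v3 (Hrefl _) (H2 v3 L3 H3)).
  - intros v1 L1 H1 v2 L2 H2 v3 V hV L3.
    exact (H1 v3 V hV (Htrans _ _ _ L2 L3) v3 (Hrefl _) (H2 v3 V hV L3)).
  - intros v1 L1 H1 v2 V hV L2.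
    rewrite eval_shift; eauto.
  - intros v1 L1 H1; rewrite eval_inst; apply H1; auto.
  - intros v1 L1 H1 v2 L2 H2 v3 u L3 R.
    exact (H1 v3 u (Htrans _ _ _ L2 L3) R u (Hrefl _) (H2 v3 u L3 R)).
  - intros v1 L1 H1 v2 L2 H2 v3 V hV L3 v4 L4 H4.
    apply (H2 v4 V hV (Htrans _ _ _ L3 L4) v4 (Hrefl v4)).
    intros v5 u5 L5 R5 u6 L6 H6.
    change (eval I (scons V s) (shift A) u6) in H6; rewrite eval_shift in H6.
    apply (H4 v5 u5 L5 R5 u6 L6).
    change (eval I (scons V s) (shift C) u6); rewrite eval_shift.
    exact (H1 v5 u5 (Htrans _ _ _ L2 (Htrans _ _ _ L3 (Htrans _ _ _ L4 L5)))
      R5 u6 L6 H6).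
  - intros v1 L1 H1 v2 L2 H2 v3 u L3 R.
    exact (H1 v3 u (Htrans _ _ _ L2 L3) R u (Hrefl _) (H2 v3 u L3 R)).
  - intros v1 L1 H1 v2 L2 H2 v3 V hV L3 v4 L4 H4.
    apply (H2 v4 V hV (Htrans _ _ _ L3 L4) v4 (Hrefl v4)).
    intros v5 u5 L5 R5 u6 L6 H6.
    change (eval I (scons V s) (shift A) u6) in H6; rewrite eval_shift in H6.
    apply (H4 v5 u5 L5 R5 u6 L6).
    change (eval I (scons V s) (shift C) u6); rewrite eval_shift.
    exact (H1 v5 u5 (Htrans _ _ _ L2 (Htrans _ _ _ L3 (Htrans _ _ _ L4 L5)))
      R5 u6 L6 H6).
  - intros v1 L1 H1.
    (* The quantifier inside [BDia] is instantiated with the denotation of [A] itself. *)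
    apply (H1 v1 (eval I s A) (hev A) (Hrefl _) v1 (Hrefl _)).
    intros v2 u2 L2 R2 u3 L3 H3.
    change (eval I (scons (eval I s A) s) (shift (Box A)) u3) in H3.
    rewrite eval_shift in H3; exact H3.
  - intros v1 L1 H1 v2 u2 L2 R2 u3 V hV L3 u4 L4 H4.
    (* [H4] speaks of predecessors of [u4], so [v2] is lifted to a predecessor [v4], where [A]
       persists; the box obtained at [v4] is then used back at [u4]. *)
    destruct (acc_forth R2 (Htrans _ _ _ L3 L4)) as (v4 & M4 & R4).
    apply (H4 u4 v4 (Hrefl _) R4 v4 (Hrefl _)) with (v' := v4); auto.
    change (eval I (scons V s) (shift A) v4); rewrite eval_shift.
    exact (Hup A s v1 v4 hs (Htrans _ _ _ L2 M4) H1).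
  - intros v1 L1 H1.
    apply (H1 v1 (eval I s A) (hev A) (Hrefl _) v1 (Hrefl _)).
    intros v2 u2 L2 R2 u3 L3 H3.
    change (eval I (scons (eval I s A) s) (shift (BBox A)) u3) in H3.
    rewrite eval_shift in H3; exact H3.
  - intros v1 L1 H1 v2 u2 L2 R2 u3 V hV L3 u4 L4 H4.
    destruct (acc_back (Htrans _ _ _ L3 L4) R2) as (v4 & R4 & M4).
    apply (H4 u4 v4 (Hrefl _) R4 v4 (Hrefl _)) with (v' := v4); auto.
    change (eval I (scons V s) (shift A) v4); rewrite eval_shift.
    exact (Hup A s v1 v4 hs (Htrans _ _ _ L2 M4) H1).
  - apply (IH1 I s hI hs w w (Hrefl w)), IH2; auto.
  - intros v V hV _.
    (* Reading [p] as [V] does not change the denotation of [A], since [p] is fresh for it. *)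
    set (J q := if Nat.eq_dec p q then V else I q).
    assert (hJ : forall q, In _ (adm B) (J q))
      by (intro q; unfold J; destruct Nat.eq_dec; auto).
    specialize (IH J s hJ hs v); rewrite eval_inst in IH.
    replace (eval J s (Atom p)) with V in IH
      by (simpl; unfold J; destruct Nat.eq_dec; congruence).
    rewrite eval_fresh with (p := p) (J := J); [exact IH|exact hp|].
    intros q hq; unfold J; destruct Nat.eq_dec; congruence.
  - intros v u _ _; apply IH; auto.
  - intros v u _ _; apply IH; auto.
Qed.

(** * Deduction theorem and derived laws of the calculus *)

Inductive derives (G : list formula) : formula -> Prop :=
| d_hyp A : List.In A G -> derives G A
| d_thm A : IKt2 A -> derives G A
| d_mp A C : derives G (A --> C) -> derives G A -> derives G C.

Lemma thm_id A : IKt2 (A --> A).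
Proof. exact (rule_mp (rule_mp (ax_S A (A --> A) A) (ax_K _ _)) (ax_K _ _)). Qed.

(** No side condition arises: hypotheses are combined by modus ponens alone, while necessitation and
    generalisation enter only through [d_thm]. *)
Lemma deduction G A C : derives (A :: G) C -> derives G (A --> C).
Proof.
  induction 1 as [C [<-|H]|C H|C D _ IH1 _ IH2].
  - apply d_thm, thm_id.
  - eapply d_mp; [apply d_thm, ax_K|apply d_hyp, H].
  - apply d_thm; exact (rule_mp (ax_K _ _) H).
  - eapply d_mp; [|exact IH2].
    eapply d_mp; [apply d_thm, ax_S|exact IH1].
Qed.

Lemma derives_nil A : derives nil A -> IKt2 A.
Proof.
  induction 1 as [A []|A H|A C _ IH1 _ IH2]; [exact H|exact (rule_mp IH1 IH2)].
Qed.

Ltac hyp := apply d_hyp; simpl; tauto.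
Ltac deduce := apply derives_nil; repeat apply deduction.
Tactic Notation "use" constr(H) := eapply d_mp; [apply d_thm; apply H|].

Lemma imp_trans A C D : IKt2 (A --> C) -> IKt2 (C --> D) -> IKt2 (A --> D).
Proof. intros H1 H2; deduce; use H2; use H1; hyp. Qed.

Fixpoint fresh_bound (A : formula) : nat :=
  match A with
  | Atom p => S p
  | Var _ => 0
  | Imp A C => Nat.max (fresh_bound A) (fresh_bound C)
  | Box A => fresh_bound A
  | BBox A => fresh_bound A
  | All A => fresh_bound A
  end.

Lemma fresh_above p A : fresh_bound A <= p -> fresh p A.
Proof.
  induction A; simpl; intros; auto; [lia|].
  split; [apply IHA1|apply IHA2]; lia.
Qed.

Lemma fresh_ren p (A : formula) r : fresh p A -> fresh p (ren r A).
Proof. revert r; induction A; simpl; intuition auto. Qed.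

(** Generalise the whole implication over [p], distribute the quantifier, and quantify [A]
    vacuously. *)
Lemma all_intro p A C :
  fresh p A -> fresh p C -> IKt2 (A --> inst C (Atom p)) -> IKt2 (A --> All C).
Proof.
  intros hA hC H.
  assert (K : IKt2 (All (shift A --> C))).
  { apply rule_gen with p; [split; [apply fresh_ren, hA|exact hC]|].
    change (IKt2 (inst (shift A) (Atom p) --> inst C (Atom p))).
    rewrite inst_shift; exact H. }
  deduce; eapply d_mp; [use ax_all_dist; apply d_thm, K|use ax_all_vac; hyp].
Qed.

Definition And (A C : formula) : formula :=
  All ((shift A --> shift C --> Var 0) --> Var 0).

Lemma inst_And_body (A C D : formula) :
  inst ((shift A --> shift C --> Var 0) --> Var 0) D = (A --> C --> D) --> D.
Proof.
  change (((inst (shift A) D --> inst (shift C) D --> D) --> D)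
    = (A --> C --> D) --> D).
  rewrite !inst_shift; reflexivity.
Qed.

Lemma and_elim A C D : IKt2 (And A C --> (A --> C --> D) --> D).
Proof. rewrite <- inst_And_body; apply ax_comprehension. Qed.

Lemma and_l A C : IKt2 (And A C --> A).
Proof. deduce; eapply d_mp; [use and_elim; hyp|apply d_thm, ax_K]. Qed.

Lemma and_r A C : IKt2 (And A C --> C).
Proof.
  deduce; eapply d_mp; [use and_elim; hyp|].
  do 2 apply deduction; hyp.
Qed.

Lemma and_intro A C : IKt2 (A --> C --> And A C).
Proof.
  set (D := (shift A --> shift C --> Var 0) --> Var 0).
  set (p := Nat.max (fresh_bound A) (fresh_bound C)).
  assert (hA : fresh p A) by (apply fresh_above; lia).
  assert (hC : fresh p C) by (apply fresh_above; lia).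
  assert (K : IKt2 (All (shift A --> shift C --> D))).
  { apply rule_gen with p; [simpl; unfold shift; auto 10 using fresh_ren|].
    change (IKt2 (inst (shift A) (Atom p) --> inst (shift C) (Atom p) -->
      inst D (Atom p))).
    unfold D; rewrite inst_And_body, !inst_shift.
    deduce; eapply d_mp; [eapply d_mp|]; hyp. }
  deduce; eapply d_mp; [use ax_all_dist|use ax_all_vac; hyp].
  eapply d_mp; [use ax_all_dist; apply d_thm, K|use ax_all_vac; hyp].
Qed.

Lemma dia_mono A C : IKt2 (A --> C) -> IKt2 (Dia A --> Dia C).
Proof. intro H; exact (rule_mp (ax_dia_dist _ _) (rule_nec_box H)). Qed.

Lemma bdia_mono A C : IKt2 (A --> C) -> IKt2 (BDia A --> BDia C).
Proof. intro H; exact (rule_mp (ax_bdia_dist _ _) (rule_nec_bbox H)). Qed.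

Lemma box_mono A C : IKt2 (A --> C) -> IKt2 (Box A --> Box C).
Proof. intro H; exact (rule_mp (ax_box_dist _ _) (rule_nec_box H)). Qed.

Lemma bbox_mono A C : IKt2 (A --> C) -> IKt2 (BBox A --> BBox C).
Proof. intro H; exact (rule_mp (ax_bbox_dist _ _) (rule_nec_bbox H)). Qed.

(** [Box C] yields [Box (A --> And A C)], to which the distribution axiom for [Dia] applies. *)
Lemma dia_and F A C :
  IKt2 (F --> Dia A) -> IKt2 (F --> Box C) -> IKt2 (F --> Dia (And A C)).
Proof.
  intros H1 H2; deduce; eapply d_mp; [use ax_dia_dist|use H1; hyp].
  use box_mono; [|use H2; hyp].
  deduce; eapply d_mp; [use and_intro|]; hyp.
Qed.

Lemma bdia_and F A C :
  IKt2 (F --> BDia A) -> IKt2 (F --> BBox C) -> IKt2 (F --> BDia (And A C)).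
Proof.
  intros H1 H2; deduce; eapply d_mp; [use ax_bdia_dist|use H1; hyp].
  use bbox_mono; [|use H2; hyp].
  deduce; eapply d_mp; [use and_intro|]; hyp.
Qed.

(** * The canonical model and completeness *)

Definition theory : Type :=
  {T : Ensemble formula | exists F, T = fun A => IKt2 (F --> A)}.

Definition Th (F : formula) : theory :=
  exist _ (fun A => IKt2 (F --> A)) (ex_intro _ F eq_refl).

Lemma theory_Th (T : theory) : exists F, T = Th F.
Proof.
  destruct T as [T [F ->]]; exists F; reflexivity.
Qed.

Definition th_le (T U : theory) : Prop :=
  forall A, proj1_sig T A -> proj1_sig U A.

Definition th_acc (T U : theory) : Prop :=
  (forall A, proj1_sig U A -> proj1_sig T (Dia A)) /\
  (forall A, proj1_sig T A -> proj1_sig U (BDia A)).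

Definition extent (A : formula) : Ensemble theory := fun T => proj1_sig T A.

(** Open formulas count as well. With this choice, quantifying over admissible sets amounts to
    quantifying over instances of a formula. *)
Definition th_adm : Ensemble (Ensemble theory) :=
  fun V => exists A, V = extent A.

Lemma th_le_Th F G : th_le (Th F) (Th G) <-> IKt2 (G --> F).
Proof.
  split; [intro H; apply H, thm_id|].
  intros H A; apply imp_trans, H.
Qed.

(** By monotonicity of the diamonds, accessibility need only be checked on generators. *)
Lemma th_acc_Th F G :
  th_acc (Th F) (Th G) <-> IKt2 (F --> Dia G) /\ IKt2 (G --> BDia F).
Proof.
  split.
  - intros [H1 H2]; split; [apply H1, thm_id|apply H2, thm_id].
  - intros [H1 H2]; split; intros A H; simpl.
    + exact (imp_trans H1 (dia_mono H)).
    + exact (imp_trans H2 (bdia_mono H)).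
Qed.

(** Antisymmetry is why worlds are sets of formulas and not their generators: interderivable
    formulas generate one theory. *)
Lemma th_order : order theory th_le.
Proof.
  split.
  - intros T A H; exact H.
  - intros T U V H1 H2 A H; exact (H2 A (H1 A H)).
  - intros [T hT] [U hU] H1 H2.
    assert (E : T = U) by (apply ensemble_ext; intro A; split; [apply H1|apply H2]).
    subst U; f_equal; apply proof_irrelevance.
Qed.

Lemma th_adm_upward V : In _ th_adm V ->
  forall T U, th_le T U -> In _ V T -> In _ V U.
Proof. intros [A ->] T U H; apply H. Qed.

Lemma extent_Atom_adm p : In _ th_adm (extent (Atom p)).
Proof. exists (Atom p); reflexivity. Qed.

Lemma th_acc_forth T U U' : th_acc T U -> th_le U U' ->
  exists T', th_le T T' /\ th_acc T' U'.
Proof.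
  destruct (theory_Th T) as [F ->], (theory_Th U) as [G ->], (theory_Th U') as [G' ->].
  rewrite th_acc_Th, th_le_Th; intros [_ H2] H.
  exists (Th (And F (Dia G'))); rewrite th_acc_Th, th_le_Th.
  split; [apply and_l|split; [apply and_r|]].
  (* [G'] proves [BDia F] through [G], and [BBox (Dia G')] by a tense axiom. *)
  apply bdia_and; [exact (imp_trans H H2)|apply ax_bbox_dia].
Qed.

Lemma th_acc_back T T' U : th_le T T' -> th_acc T U ->
  exists U', th_acc T' U' /\ th_le U U'.
Proof.
  destruct (theory_Th T) as [F ->], (theory_Th U) as [G ->], (theory_Th T') as [F' ->].
  rewrite th_acc_Th, th_le_Th; intros H [H1 _].
  exists (Th (And G (BDia F'))); rewrite th_acc_Th, th_le_Th.
  split; [split; [|apply and_r]|apply and_l].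
  apply dia_and; [exact (imp_trans H H1)|apply ax_box_bdia].
Qed.

Definition canonical : birel_structure :=
  BirelStructure th_order th_adm_upward extent_Atom_adm th_acc_forth th_acc_back.

(** Arbitrary [s] lets the induction pass quantifiers; arbitrary [g] and symbol type make the result
    cover the expanded language too. *)
Lemma canonical_truth P (g : P -> formula) s A :
  eval (B := canonical) (fun p => extent (g p)) (fun i => extent (s i)) A
  = extent (bind g s A).
Proof.
  revert g s; induction A as [p|i|A IHA C IHC|A IH|A IH|A IH]; intros g s;
    try reflexivity; apply ensemble_ext; intro T;
    destruct (theory_Th T) as [F ->]; simpl.
  - rewrite IHA, IHC; unfold extent; split.
    (* The least extension of [Th F] that contains the antecedent. *)
    + intro H; specialize (H (Th (And F (bind g s A)))).
      rewrite th_le_Th in H; simpl in H.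
      specialize (H (and_l _ _) (and_r _ _)).
      deduce; use H; eapply d_mp; [use and_intro|]; hyp.
    + intros H T' HT H1; destruct (theory_Th T') as [F' ->].
      rewrite th_le_Th in HT; simpl in *.
      deduce; eapply d_mp; [use H; use HT|use H1]; hyp.
  - rewrite IH; unfold extent; split.
    + intro H; specialize (H (Th (And F (Dia (BDia F)))) (Th (BDia F))).
      rewrite th_le_Th, th_acc_Th in H.
      refine (imp_trans (ax_box_bdia F) (box_mono (H _ (conj _ _)))).
      * apply and_l.
      * apply and_r.
      * apply bdia_and; [apply thm_id|apply ax_bbox_dia].
    + intros H T' U HT HU.
      destruct (theory_Th T') as [F' ->], (theory_Th U) as [G ->].
      rewrite th_le_Th in HT; rewrite th_acc_Th in HU.
      (* [G] proves [BDia F'], hence [BDia] of the boxed formula, hence the formula itself. *)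
      exact (imp_trans (imp_trans (proj2 HU) (bdia_mono (imp_trans HT H)))
        (ax_bdia_box _)).
  - rewrite IH; unfold extent; split.
    + intro H; specialize (H (Th (And F (BDia (Dia F)))) (Th (Dia F))).
      rewrite th_le_Th, th_acc_Th in H.
      refine (imp_trans (ax_bbox_dia F) (bbox_mono (H _ (conj _ _)))).
      * apply and_l.
      * apply dia_and; [apply thm_id|apply ax_box_bdia].
      * apply and_r.
    + intros H T' U HT HU.
      destruct (theory_Th T') as [F' ->], (theory_Th U) as [G ->].
      rewrite th_le_Th in HT; rewrite th_acc_Th in HU.
      exact (imp_trans (imp_trans (proj1 HU) (dia_mono (imp_trans HT H)))
        (ax_dia_bbox _)).
  - set (C := bind (fun p => shift (g p)) (up s) A).
    assert (E : forall D, eval (B := canonical) (fun p => extent (g p))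
      (scons (extent D) (fun i => extent (s i))) A = extent (inst C D)).
    { intro D; unfold C; rewrite inst_bind_up, <- IH; f_equal.
      extensionality i; destruct i; reflexivity. }
    split.
    + intro H.
      (* The single instance [extent (Atom p)], taken at [Th F] itself, suffices: [p] is generic for
         both [F] and [C]. *)
      set (p := Nat.max (fresh_bound F) (fresh_bound C)).
      apply all_intro with p; try (apply fresh_above; lia).
      specialize (H (Th F) _ (extent_Atom_adm p)); rewrite E in H.
      apply H; intros D HD; exact HD.
    + intros H T' V [D ->] HT; rewrite E; destruct (theory_Th T') as [F' ->].
      exact (imp_trans (HT _ H) (ax_comprehension _ _)).
Qed.

Lemma canonical_comprehensive : comprehensive canonical.
Proof.
  intros C hC.
  (* Admissibility only asserts that a defining formula exists; choice selects one for each symbol,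
     and substituting these into [C] gives the formula that defines its extension. *)
  destruct (functional_choice (fun (a : esymbol canonical) A => interp a = extent A)
    (fun a : esymbol canonical => match a with
      | Sym p => ex_intro _ (Atom p) eq_refl
      | Adm hV => hV
      end)) as [g hg].
  exists (bind g (fun i => Var i) C).
  rewrite <- canonical_truth; apply ensemble_ext; intro T.
  rewrite (sat_closed_eval (B := canonical) (fun i => extent (Var i))) by exact hC.
  replace (@interp canonical) with (fun a => extent (g a))
    by (extensionality a; symmetry; apply hg).
  reflexivity.
Qed.

Theorem theoremA (A : formula) (hA : closed A) :
  IKt2 A <-> (forall B : birel_model, valid B A).
Proof.
  split.
  - intros H B w.
    (* Any admissible environment would do, [A] being closed; [val B 0] is one at hand. *)
    apply (sat_map_atoms_eval (fun _ => val B 0) w hA).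
    apply soundness; intros; try apply val_adm; exact H.
  - intro H.
    (* Generated by a provable formula, this world is the set of all theorems. *)
    specialize (H (BirelModel canonical_comprehensive) (Th (Var 0 --> Var 0))).
    rewrite (sat_map_atoms_eval (B := canonical) (fun i => extent (Var i)) _ hA) in H.
    change (eval (B := canonical) (fun p => extent (Atom p))
      (fun i => extent (Var i)) A (Th (Var 0 --> Var 0))) in H.
    rewrite canonical_truth, bind_Atom, subst_Var in H.
    exact (rule_mp H (thm_id _)).
Qed.
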